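(* Let $v_1,v_2,v_3>0$ be constant velocities satisfying simultaneously $v_1<v_3$ and $v_1+v_3\leq v_2$. Let $f\colon\triangle\to\triangle$ be the reset function of the three-worker bucket brigade with these constant velocities, where $\triangle=\{(x,y)\colon 0\leq x\leq y\leq 1\}$, and let $p^\star=\Bigl(\frac{v_1}{v_1+v_2+v_3},\frac{v_1+v_2}{v_1+v_2+v_3}\Bigr)$ be its unique fixed point. Then there exist infinitely many initial positions $(x,y)\in\triangle$ for which there is convergence to the fixed point, i.e., $f^k(x,y)\to p^\star$ as $k\to\infty$.
   Context: Three-worker bucket brigade with constant velocities $v_1,v_2,v_3>0$. Three workers, numbered $1,2,3$ along a production line identified with $[0,1]$, have positions $0\leq x_1\leq x_2\leq x_3\leq 1$. All workers move forward. Worker $3$ always moves at velocity $v_3$. For $i\in\{1,2\}$, worker $i$ moves at velocity $v_i$ as long as he has not caught up with worker $i+1$. When he has caught up with worker $i+1$, he cannot overtake him and adjusts his velocity to that of worker $i+1$. Formally, $\dot x_3=v_3$, and for $i=1,2$: $\dot x_i=v_i$ if $x_i<x_{i+1}$, and $\dot x_i=\min(v_i,\dot x_{i+1})$ if $x_i=x_{i+1}$. Let $T$ be the smallest time $t\geq 0$ with $x_3(t)=1$. At time $T$ a reset occurs instantaneously: worker $3$ is sent to position $x_2(T)$, worker $2$ to position $x_1(T)$, and worker $1$ to position $0$. The reset function $f\colon\triangle\to\triangle$ maps $(x,y)$ to $(x',y')$, where, starting at time $0$ from positions $(x_1,x_2,x_3)=(0,x,y)$, the positions just after the first reset are $(0,x',y')$;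 that is, $x'=x_1(T)$ and $y'=x_2(T)$. A point $(x,y)\in\triangle$ is identified with the initial position $(0,x,y)$ of the workers, and $f^k$ is the $k$-th iterate of $f$. *)

(* Defs.v *)
From HB Require Import structures.
From mathcomp Require Import all_boot all_order all_algebra.
From mathcomp Require Import all_classical all_reals all_analysis.
Set Implicit Arguments.
Unset Strict Implicit.
Unset Printing Implicit Defensive.
Import Order.TTheory GRing.Theory Num.Theory.
Import numFieldNormedType.Exports.
Local Open Scope classical_set_scope.
Local Open Scope ring_scope.

Definition triangle (R : realType) : set (R * R) :=
  [set p | 0 <= p.1 /\ p.1 <= p.2 /\ p.2 <= 1].

(** A worker's velocity jumps when he catches up with his successor, so the
    equations of motion are read with right derivatives. *)
Definition has_velocity (R : realType) (x : R -> R) (t u : R) : Prop :=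
  h^-1 * (x (t + h) - x t) @[h --> 0^'+] --> u.

(** Velocity prescribed to a worker at position [x] with own velocity [v], whose
    successor is at position [xnext] and currently moves at velocity [unext]. *)
Definition follow (R : realType) (v x xnext unext : R) : R :=
  if x < xnext then v else Num.min v unext.

Definition motion (R : realType) (v1 v2 v3 T : R) (x1 x2 x3 : R -> R) : Prop :=
  [/\ {within `[0, T], continuous x1},
      {within `[0, T], continuous x2},
      {within `[0, T], continuous x3},
      forall t, 0 <= t <= T ->
        [/\ 0 <= x1 t, x1 t <= x2 t, x2 t <= x3 t & x3 t <= 1]
    & forall t, 0 <= t < T ->
        let u3 := v3 in
        let u2 := follow v2 (x2 t) (x3 t) u3 in
        let u1 := follow v1 (x1 t) (x2 t) u2 in
        [/\ has_velocity x1 t u1, has_velocity x2 t u2 & has_velocity x3 t u3]].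

Definition first_completion (R : realType) (x3 : R -> R) (T : R) : Prop :=
  [/\ 0 <= T, x3 T = 1 & forall t, 0 <= t < T -> x3 t <> 1].

(** [q] gives the positions of workers 2 and 3 just after the first reset,
    starting from [(0, p.1, p.2)]. *)
Definition reset_to (R : realType) (v1 v2 v3 : R) (p q : R * R) : Prop :=
  exists (T : R) (x1 x2 x3 : R -> R),
    [/\ motion v1 v2 v3 T x1 x2 x3,
        [/\ x1 0 = 0, x2 0 = p.1 & x3 0 = p.2],
        first_completion x3 T
      & q = (x1 T, x2 T)].

(** For positive velocities and [p] in the triangle there is exactly one such
    [q]; the default value [p] is only used outside the triangle. *)
Definition reset_function (R : realType) (v1 v2 v3 : R) (p : R * R) : R * R :=
  xget p [set q | reset_to v1 v2 v3 p q].

Definition fixed_point (R : realType) (v1 v2 v3 : R) : R * R :=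
  (v1 / (v1 + v2 + v3), (v1 + v2) / (v1 + v2 + v3)).

(* Main.v *)
Require Import Defs.
From HB Require Import structures.
From mathcomp Require Import all_boot all_order all_algebra.
From mathcomp Require Import all_classical all_reals all_analysis.
From mathcomp Require Import ring lra.
Import Order.TTheory GRing.Theory Num.Theory.
Import numFieldNormedType.Exports.
Local Open Scope classical_set_scope.
Local Open Scope ring_scope.

(* Near the fixed point no worker catches up before the reset, so the reset
   function is affine there. Its linear part has real eigenvalues, one of them
   in ]-1, 0[; along the corresponding eigenline through the fixed point the
   map is a contraction towards it. The resets themselves are only determined by
   right derivatives, so uniqueness of the motion rests on a one-sided mean value
   inequality. *)

(** * Right derivatives and mean value bounds *)

Lemma has_velocityN (R : realType) (x : R -> R) (t u : R) :
  has_velocity x t u -> has_velocity (fun s => - x s) t (- u).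
Proof.
move=> xtu; rewrite /has_velocity.
under eq_fun do rewrite -opprD mulrN.
exact: cvgN.
Qed.

Lemma has_velocity_affine (R : realType) (a v t : R) :
  has_velocity (fun s => a + v * s) t v.
Proof.
apply: (@cvg_trans _ (v @[h --> 0^'+])); last exact: cvg_cst.
apply: near_eq_cvg; near=> h.
have h0 : h != 0 by rewrite gt_eqF//; near: h; exact: nbhs_right_gt.
by field.
Unshelve. all: by end_near. Qed.

(* If the chord slope c = (x T - x 0) / T exceeded v, then x s - c * s would take
   its minimum over [0, T] at some s < T (the values at 0 and T agree), where
   its right derivative is negative. *)
Lemma velocity_le (R : realType) (x : R -> R) (v T : R) : 0 <= T ->
  {within `[0, T], continuous x} ->
  (forall t : R, 0 <= t < T -> exists2 u, has_velocity x t u & u <= v) ->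
  x T <= x 0 + v * T.
Proof.
move=> T0 xc xv; rewrite leNgt; apply/negP => xT.
have {}T0 : 0 < T.
  rewrite lt_neqAle T0 andbT; apply/eqP => T0'.
  by move: xT; rewrite -T0' mulr0 addr0 ltxx.
pose c := (x T - x 0) / T.
have cT : c * T = x T - x 0 by rewrite /c mulfVK// gt_eqF.
have vc : v < c by rewrite -(ltr_pM2r T0) cT; lra.
pose g s := x s - c * s.
have gc : {within `[0, T], continuous g}.
  move=> s; apply: cvgB; first exact: xc.
  by apply: continuous_subspaceT => ?; apply: cvgM; [exact: cvg_cst|exact: cvg_id].
have gT : g T = g 0 by rewrite /g cT mulr0; lra.
have [s sT gmin] : exists2 s : R, 0 <= s < T & forall t : R, 0 <= t <= T -> g s <= g t.
  have [s] := EVT_min (ltW T0) gc; rewrite in_itv/= => /andP[s0 sT] smin.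
  have [s_lt|s_ge] := ltP s T.
    by exists s => [|t tT]; [rewrite s0|apply: smin; rewrite in_itv].
  exists 0 => [|t tT]; first by rewrite lexx T0.
  have <- : g T = g 0 by [].
  have -> : T = s by apply/le_anti; rewrite sT s_ge.
  by apply: smin; rewrite in_itv.
have [u xu uv] := xv _ sT; case/andP: sT => s0 sT.
have h_near : \forall h \near 0^'+, g (s + h) < g s.
  have := @cvgr_lt _ _ _ _ _ _ xu _ (le_lt_trans uv vc) => slope; near=> h.
  have h0 : 0 < h by near: h; exact: nbhs_right_gt.
  have : h^-1 * (x (s + h) - x s) < c by near: h; exact: slope.
  by rewrite mulrC ltr_pdivrMr// /g; lra.
have sT0 : 0 < T - s by lra.
have [h [gh [/= h0 hT]]] :=
  filter_ex (filterI h_near (filterI (nbhs_right_gt 0) (nbhs_right_lt sT0))).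
by move: gh; rewrite ltNge gmin//; lra.
Unshelve. all: by end_near. Qed.

(** The one-sided bound applied to [x] and to [- x]; it recovers a trajectory from its right
    derivative alone. *)
Lemma velocity_eq (R : realType) (x : R -> R) (v T : R) : 0 <= T ->
  {within `[0, T], continuous x} ->
  (forall t : R, 0 <= t < T -> has_velocity x t v) ->
  x T = x 0 + v * T.
Proof.
move=> T0 xc xv; apply/le_anti/andP; split.
  by apply: velocity_le => // t tT; exists v => //; exact: xv.
suff : - x T <= - x 0 + - v * T by lra.
apply: (velocity_le _ (fun t => - x t)) => //.
  by move=> t; apply: cvgN; exact: xc.
by move=> t tT; exists (- v) => //; exact/has_velocityN/xv.
Qed.

Lemma within_continuous_prefix {R : realType} {x : R -> R} {T : R} (t : R) :
  t <= T -> {within `[0, T], continuous x} -> {within `[0, t], continuous x}.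
Proof.
move=> tT; apply: continuous_subspaceW => s /=; rewrite !in_itv/= => /andP[-> st].
exact: le_trans tT.
Qed.

Lemma affine_continuous (R : realType) (a v : R) : continuous (fun s => a + v * s).
Proof.
move=> s; apply: cvgD; first exact: cvg_cst.
by apply: cvgM; [exact: cvg_cst|exact: cvg_id].
Qed.

(** * Resets in which nobody catches up *)

Lemma affine_lt (R : realFieldType) (a b v w T t : R) : 0 < T ->
  a < b -> a + v * T < b + w * T -> 0 <= t <= T -> a + v * t < b + w * t.
Proof.
move=> T0 ab abT /andP[t0 tT]; rewrite -subr_gt0 -(pmulr_rgt0 _ T0).
(* [T] times the gap at [t] combines the two end gaps with nonnegative weights [T - t] and [t], at
   least one of them positive. *)
have -> : T * (b + w * t - (a + v * t)) =
    (T - t) * (b - a) + t * (b + w * T - (a + v * T)) by ring.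
have [tT'|tT'] := ltP t T.
  by apply: ltr_wpDr; rewrite ?mulr_ge0 ?mulr_gt0 ?subr_gt0// subr_ge0 ltW.
apply: ltr_wpDl; rewrite ?mulr_ge0 ?mulr_gt0 ?subr_ge0 ?subr_gt0//; first exact: ltW.
exact: lt_le_trans tT'.
Qed.

(** Straight-line motions satisfy the equations: [x > 0] and [v1 <= v2] keep worker 1 behind worker
    2, and comparing positions at times [0] and [T] keeps worker 2 behind worker 3. *)
Lemma reset_to_free (R : realType) (v1 v2 v3 x y T : R) :
  0 < v1 -> 0 < v3 -> v1 <= v2 -> 0 < x -> x < y -> 0 < T ->
  y + v3 * T = 1 -> x + v2 * T < 1 ->
  reset_to v1 v2 v3 (x, y) (v1 * T, x + v2 * T).
Proof.
move=> v10 v30 v12 x0 xy T0 yT xT.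
have lt12 (t : R) : 0 <= t -> v1 * t < x + v2 * t.
  by move=> t0; apply: ltr_pwDl => //; exact: ler_wpM2r.
have lt23 (t : R) : 0 <= t <= T -> x + v2 * t < y + v3 * t.
  by apply: affine_lt; rewrite ?yT.
exists T, (fun t => 0 + v1 * t), (fun t => x + v2 * t), (fun t => y + v3 * t).
split; last by rewrite add0r.
- split; try (apply: continuous_subspaceT; exact: affine_continuous).
    move=> t tT; have /ltW := lt23 _ tT; case/andP: tT => t0 tT.
    move: (lt12 _ t0) => /ltW; rewrite add0r; split=> //.
      by rewrite mulr_ge0// ltW.
    by rewrite -yT lerD2l ler_pM2l.
  move=> t /andP[t0 tT] /=.
  rewrite /follow add0r lt12// lt23 ?t0 ?ltW//.
  by split; exact: has_velocity_affine.
- by rewrite /= !mulr0 !addr0.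
- split; [exact: ltW|exact: yT|move=> t /andP[_ tT]].
  by apply/eqP; rewrite lt_eqF// -yT ltrD2l ltr_pM2l.
Qed.

(** Worker 3 moves independently of the others and fixes the reset time. Worker 2 never exceeds
    [v2], so he stays strictly behind worker 3 and moves at exactly [v2]. *)
Lemma reset_to_free_uniq (R : realType) (v1 v2 v3 x y T : R) (q : R * R) :
  0 < v3 -> v1 <= v2 -> x < y -> 0 < T ->
  y + v3 * T = 1 -> x + v2 * T < 1 ->
  reset_to v1 v2 v3 (x, y) q -> q = (v1 * T, x + v2 * T).
Proof.
move=> v30 v12 xy T0 yT xT.
have lt23 (t : R) : 0 <= t <= T -> x + v2 * t < y + v3 * t.
  by apply: affine_lt; rewrite ?yT.
move=> [S [x1 [x2 [x3 [[c1 c2 c3 ord vel] [x10 x20 x30] [S0 x3S _] ->]]]]].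
have x3E (t : R) : 0 <= t <= S -> x3 t = y + v3 * t.
  move=> /andP[t0 tS]; rewrite (velocity_eq _ x3 v3) ?x30//.
    exact: within_continuous_prefix c3.
  by move=> s /andP[s0 st]; have [|//] := vel s; rewrite s0 (lt_le_trans st).
have ST : S = T.
  apply: (mulfI (lt0r_neq0 v30)); apply: (addrI y).
  by rewrite yT -x3E ?x3S// S0 lexx.
subst S.
have x2_le (t : R) : 0 <= t <= T -> x2 t <= x + v2 * t.
  move=> /andP[t0 tT]; rewrite -[x]x20; apply: velocity_le => //.
    exact: within_continuous_prefix c2.
  move=> s /andP[s0 st]; have [|_ x2v _] := vel s; first by rewrite s0 (lt_le_trans st).
  exists (follow v2 (x2 s) (x3 s) v3) => //.
  by rewrite /follow; case: ifP => // _; rewrite ge_min lexx.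
have x23 (t : R) : 0 <= t < T -> x2 t < x3 t.
  move=> /andP[t0 /ltW tT]; have tT' : 0 <= t <= T by rewrite t0.
  by rewrite x3E// (le_lt_trans (x2_le _ tT'))// lt23.
have x2v (t : R) : 0 <= t < T -> has_velocity x2 t v2.
  by move=> tT; have [_ + _] := vel t tT; rewrite /follow x23.
have x1v (t : R) : 0 <= t < T -> has_velocity x1 t v1.
  move=> tT; have [+ _ _] := vel t tT; rewrite /follow x23//.
  (* Even in contact with worker 2, worker 1 would move at [min v1 v2], which is [v1]. *)
  by rewrite (min_idPl v12) if_same.
by rewrite (velocity_eq _ x1 v1)// (velocity_eq _ x2 v2)// x10 x20 add0r.
Qed.

Lemma reset_function_free (R : realType) (v1 v2 v3 x y : R) :
  0 < v1 -> 0 < v3 -> v1 <= v2 ->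
  [/\ 0 < x, x < y, y < 1 & x + v2 / v3 * (1 - y) < 1] ->
  reset_function v1 v2 v3 (x, y) = (v1 / v3 * (1 - y), x + v2 / v3 * (1 - y)).
Proof.
move=> v10 v30 v12 [x0 xy y1].
rewrite ![_ / v3 * _]mulrAC -!mulrA; set T := (1 - y) / v3 => xT.
have T0 : 0 < T by rewrite divr_gt0 ?subr_gt0.
have yT : y + v3 * T = 1 by rewrite mulrC divfK ?gt_eqF// subrKC.
apply: xget_unique; first exact: (reset_to_free _ _ _ _ x y).
by move=> q; exact: (reset_to_free_uniq _ _ _ _ x y).
Qed.

(** * The contracting eigenline through the fixed point *)

(* The linear part (dx, dy) |-> (- a dy, dx - b dy) of the reset function has the
   eigenvector (l + b, 1) whenever l^2 + b l + a = 0; as the two roots have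
   product a < 1 and the polynomial is nonpositive at -1, exactly one of them
   is contracting. *)
Lemma contracting_root (R : rcfType) (a b : R) : 0 < a < 1 -> a + 1 <= b ->
  exists2 l : R, -1 < l < 0 & l * (l + b) = - a.
Proof.
move=> /andP[a0 a1] ab; pose d := Num.sqrt (b ^+ 2 - 4 * a).
have d0 : 0 <= d by exact: sqrtr_ge0.
(* Since [b >= a + 1], the discriminant is at least [(1 - a)^2]; the witness below is the larger
   root. *)
have d2 : d ^+ 2 = b ^+ 2 - 4 * a by rewrite sqr_sqrtr//; nra.
exists ((d - b) / 2); last by nra.
have db : d < b by rewrite -(ltr_pXn2r (n := 2))// ?nnegrE; lra.
by nra.
Qed.

(** Rewrites the fixed point in the ratios [v1 / v3] and [v2 / v3], on which the reset map depends;
    [z] is the distance of its second coordinate from 1. *)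
Lemma fixed_pointE (R : realType) (v1 v2 v3 : R) : 0 < v1 -> 0 < v2 -> 0 < v3 ->
  exists z : R, [/\ 0 < z, (1 + v1 / v3 + v2 / v3) * z = 1 &
    fixed_point v1 v2 v3 = (v1 / v3 * z, (v1 / v3 + v2 / v3) * z)].
Proof.
move=> v10 v20 v30; have S0 : 0 < v1 + v2 + v3 by rewrite !addr_gt0.
exists (v3 / (v1 + v2 + v3)); split; first exact: divr_gt0.
  by field; rewrite !gt_eqF.
by rewrite /fixed_point; congr (_, _); field; rewrite !gt_eqF.
Qed.

(** At [s = 0] the four inequalities have slacks [a * z], [b * z], [z] and [z], all at least
    [a * z]; moving along the line changes each by at most [(1 + b) * |s|], hence the radius. *)
Lemma stable_line_free (R : realFieldType) (a b z l s : R) :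
  0 < a < 1 -> a + 1 <= b -> 0 < z -> (1 + a + b) * z = 1 -> -1 < l < 0 ->
  `|s| < a * z / (1 + b) ->
  let x := a * z + s * (l + b) in let y := (a + b) * z + s in
  [/\ 0 < x, x < y, y < 1 & x + b * (1 - y) < 1].
Proof.
move=> /andP[a0 a1] ab z0 zE /andP[l1 l0]; rewrite ltr_pdivlMr => [/= sr|]; last by lra.
have -> : 1 - ((a + b) * z + s) = z - s.
  by rewrite -[X in X - _]zE; ring.
have az : 0 < a * z by exact: mulr_gt0.
have a1z : a * z < z by rewrite gtr_pMl.
have sb0 : 0 <= `|s| * b by rewrite mulr_ge0//; lra.
have abz : (a + 1) * z <= b * z by rewrite ler_pM2r.
suff [sl sb] : `|s * l| <= `|s| /\ `|s * (l + b)| <= `|s| * b.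
  move: sl sb sb0 sr; have [s0|s0] := ger0P s; rewrite !ler_norml => sl sb sb0 sr.
    by split; lra.
  by split; lra.
rewrite !normrM (ltr0_norm l0) ler_piMr//; last lra.
by rewrite (@ger0_norm _ (l + b)) ?ler_wpM2l//; lra.
Qed.

Lemma cvg_stable_line (R : realType) (p u : R * R) (l s : R) : `|l| < 1 ->
  (p.1 + l ^+ k * s * u.1, p.2 + l ^+ k * s * u.2) @[k --> \oo] --> p.
Proof.
move=> l1; rewrite [p in _ --> p]surjective_pairing.
have ls (c : R) : l ^+ k * s * c @[k --> \oo] --> 0.
  have : l ^+ k * s * c @[k --> \oo] --> 0 * s * c.
    by apply: cvgM; [apply: cvgM; [exact: cvg_expr|exact: cvg_cst]|exact: cvg_cst].
  by rewrite !mul0r.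
have cvg_coord (a c : R) : a + l ^+ k * s * c @[k --> \oo] --> a.
  by rewrite -[X in _ --> X]addr0; apply: cvgD (ls _); exact: cvg_cst.
exact: cvg_pair (cvg_coord p.1 u.1) (cvg_coord p.2 u.2).
Qed.

Theorem proposition1p2 (R : realType) (v1 v2 v3 : R)
    (hv1 : 0 < v1) (hv2 : 0 < v2) (hv3 : 0 < v3)
    (h13 : v1 < v3) (h132 : v1 + v3 <= v2) :
  infinite_set [set p : R * R | triangle p /\
    iter k (reset_function v1 v2 v3) p @[k --> \oo] --> fixed_point v1 v2 v3].
Proof.
have [z [z0 zE pE]] := fixed_pointE _ _ _ _ hv1 hv2 hv3.
have fE x y := reset_function_free _ v1 v2 v3 x y hv1 hv3.
have a01 : 0 < v1 / v3 < 1 by rewrite divr_gt0// ltr_pdivrMr// mul1r.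
have ab : v1 / v3 + 1 <= v2 / v3.
  by rewrite -[1](divff (lt0r_neq0 hv3)) -mulrDl ler_pM2r ?invr_gt0.
have v12 : v1 <= v2 by apply: le_trans h132; rewrite lerDl ltW.
move: (v1 / v3) (v2 / v3) a01 ab zE pE fE => a b a01 ab zE -> fE.
have [l l_itv lE] := contracting_root _ _ _ a01 ab.
have l1 : `|l| < 1 by rewrite ltr_norml; lra.
(* The eigenline, parametrised by the offset of the second coordinate from the fixed point. *)
pose pt s := (a * z + s * (l + b), (a + b) * z + s).
pose r := a * z / (1 + b).
have r0 : 0 < r by rewrite divr_gt0 ?mulr_gt0//; lra.
have free s : `|s| < r -> _ := stable_line_free _ a b z l s a01 ab z0 zE l_itv.
have step s : `|s| < r -> reset_function v1 v2 v3 (pt s) = pt (l * s).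
  move=> sr; rewrite fE//; last exact: free.
  congr (_, _).
    (* Writing 1 as [(1 + a + b) * z] turns [1 - y] into [z - s]. *)
    transitivity (a * ((1 + a + b) * z - (a + b) * z - s)); first by rewrite zE; ring.
    have -> : l * s * (l + b) = s * (l * (l + b)) by ring.
    by rewrite lE; ring.
  transitivity (a * z + s * (l + b) + b * ((1 + a + b) * z - (a + b) * z - s)).
    by rewrite zE; ring.
  by ring.
have iterE s k : `|s| < r ->
    iter k (reset_function v1 v2 v3) (pt s) = pt (l ^+ k * s).
  move=> sr; elim: k => [|k IH]; first by rewrite expr0 mul1r.
  (* As [|l| < 1], the iterates stay within the radius where [step] applies. *)
  rewrite iterS IH step ?exprS ?mulrA// normrM normrX.
  by rewrite (le_lt_trans _ sr)// ler_piMl// exprn_ile1// ltW.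
(* Dividing by [n + 2] rather than [n + 1] keeps [s 0] strictly below [r]. *)
pose s (n : nat) := r / n.+2%:R.
have s_lt n : `|s n| < r.
  have n0 : 0 < n.+2%:R :> R by rewrite ltr0n.
  rewrite gtr0_norm; last exact: divr_gt0.
  by rewrite /s ltr_pdivrMr// ltr_pMr// ltr1n.
apply: (@sub_infinite_set _ (range (pt \o s))) => [_ [n _ <-]/=|].
  split.
    by have [/ltW ? /ltW ? /ltW ? _] := free _ (s_lt n).
  under eq_fun do rewrite iterE//.
  have := cvg_stable_line _ (a * z, (a + b) * z) (l + b, 1) l (s n) l1.
  by under eq_fun do rewrite /= mulr1.
rewrite (eq_finite_set (inj_card_eq _)); first exact: infinite_nat.
(* The second coordinates alone separate the points. *)
move=> m n _ _ /= [_ /addrI/(mulfI (lt0r_neq0 r0))/invr_inj/eqP].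
by rewrite eqr_nat => /eqP[].
Qed.
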